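(* Let $\lambda\in\mathbb{R}$ and $r\in\mathbb{N}\cup\{0\}$. For all integers $n,m,k\ge0$ with $n\ge m+k$, $$\binom{m+k}{m}S_{2,r}(n+r,m+k+r|\lambda)=\sum_{l=m}^{n-k}\binom{n}{l}\,S_{2,r}(l+r,m+r|\lambda)\,S_{2,\lambda}(n-l,k).$$
   Context: All generating functions are formal power series in $t$. For a number $y$, $(1+\lambda t)^{y/\lambda}$ denotes the formal power series $\sum_{n\ge0}(y|\lambda)_n\frac{t^n}{n!}$, where $(y|\lambda)_0=1$ and $(y|\lambda)_n=y(y-\lambda)(y-2\lambda)\cdots(y-(n-1)\lambda)$ for $n\ge1$ (for $\lambda=0$ this is the limit $e^{yt}$). The degenerate Stirling numbers of the second kind $S_{2,\lambda}(n,k)$ are defined, for $k\ge0$, by $$\frac{1}{k!}\left((1+\lambda t)^{1/\lambda}-1\right)^k=\sum_{n=k}^\infty S_{2,\lambda}(n,k)\frac{t^n}{n!}.$$ The extended degenerate Stirling numbers of the second kind $S_{2,r}(n+r,k+r|\lambda)$ are defined, for $r,k\in\mathbb{N}\cup\{0\}$, by $$\frac{1}{k!}(1+\lambda t)^{r/\lambda}\left((1+\lambda t)^{1/\lambda}-1\right)^k=\sum_{n=k}^\infty S_{2,r}(n+r,k+r|\lambda)\frac{t^n}{n!}.$$ *)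

(* Defs.v *)
From HB Require Import structures.
From mathcomp Require Import all_boot all_order all_algebra.
From mathcomp Require Import boolp reals zify.

Set Implicit Arguments.
Unset Strict Implicit.
Unset Printing Implicit Defensive.

Import Order.TTheory GRing.Theory Num.Theory.

Local Open Scope ring_scope.

(* Formal power series in t, as a record (rather than an alias of nat -> R) so
   that * is the Cauchy product and not the pointwise product of functions.   *)
Record fps (R : Type) := FPS { fps_coef : nat -> R }.

HB.instance Definition _ (R : Type) := [isNew for @fps_coef R].
HB.instance Definition _ (R : choiceType) := [Choice of fps R by <:].

Section FpsRing.
Variable R : comNzRingType.
Implicit Types (a b c : fps R) (x y : R).

Lemma fpsP a b : (forall n, fps_coef a n = fps_coef b n) -> a = b.
Proof. by case: a b => [a] [b] /= ab; congr FPS; apply/funext. Qed.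

Definition fps_zero : fps R := FPS (fun=> 0).
Definition fps_opp a : fps R := FPS (fun n => - fps_coef a n).
Definition fps_add a b : fps R := FPS (fun n => fps_coef a n + fps_coef b n).
Definition fps_one : fps R := FPS (fun n => (n == 0)%:R).
Definition fps_mul a b : fps R :=
  FPS (fun n => \sum_(i < n.+1) fps_coef a i * fps_coef b (n - i)).
Definition fps_scale x a : fps R := FPS (fun n => x * fps_coef a n).

Fact fps_addA : associative fps_add.
Proof. by move=> a b c; apply: fpsP => n /=; rewrite addrA. Qed.

Fact fps_addC : commutative fps_add.
Proof. by move=> a b; apply: fpsP => n /=; rewrite addrC. Qed.

Fact fps_add0 : left_id fps_zero fps_add.
Proof. by move=> a; apply: fpsP => n /=; rewrite add0r. Qed.

Fact fps_addN : left_inverse fps_zero fps_opp fps_add.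
Proof. by move=> a; apply: fpsP => n /=; rewrite addNr. Qed.

HB.instance Definition _ :=
  GRing.isZmodule.Build (fps R) fps_addA fps_addC fps_add0 fps_addN.

Let trunc N a : {poly R} := \poly_(i < N) fps_coef a i.

Let coef_trunc N a i : (i < N)%N -> (trunc N a)`_i = fps_coef a i.
Proof. by move=> iN; rewrite coef_poly iN. Qed.

Let coef_mul_trunc N a b n : (n < N)%N ->
  (trunc N a * trunc N b)`_n = fps_coef (fps_mul a b) n.
Proof.
move=> nN; rewrite coefM; apply: eq_bigr => i _.
rewrite !coef_trunc //; first exact: leq_ltn_trans (leq_subr _ _) nN.
exact: leq_ltn_trans (leq_ord i) nN.
Qed.

Fact fps_mulC : commutative fps_mul.
Proof.
move=> a b; apply: fpsP => n.
by rewrite -!(@coef_mul_trunc n.+1) // mulrC.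
Qed.

Fact fps_mulA : associative fps_mul.
Proof.
move=> a b c; apply: fpsP => n; pose T := trunc n.+1.
transitivity (T a * (T b * T c))`_n.
  rewrite coefM; apply: eq_bigr => i _.
  by rewrite coef_trunc // coef_mul_trunc // ltnS leq_subr.
rewrite mulrA coefM; apply: eq_bigr => i _.
by rewrite coef_trunc ?ltnS ?leq_subr // coef_mul_trunc.
Qed.

Fact fps_mul1 : left_id fps_one fps_mul.
Proof.
move=> a; apply: fpsP => n /=; rewrite big_ord_recl /= subn0 mul1r.
by rewrite big1 ?addr0 // => i _; rewrite mul0r.
Qed.

Fact fps_mulDl : left_distributive fps_mul fps_add.
Proof.
move=> a b c; apply: fpsP => n /=; rewrite -big_split.
by apply: eq_bigr => i _; rewrite mulrDl.
Qed.

Fact fps_one_neq0 : fps_one != 0.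
Proof.
by apply/eqP => /(congr1 (fun a => fps_coef a 0)) /eqP; rewrite oner_eq0.
Qed.

HB.instance Definition _ := GRing.Zmodule_isComNzRing.Build (fps R)
  fps_mulA fps_mulC fps_mul1 fps_mulDl fps_one_neq0.

Fact fps_scaleA x y a : fps_scale x (fps_scale y a) = fps_scale (x * y) a.
Proof. by apply: fpsP => n /=; rewrite mulrA. Qed.

Fact fps_scale1 : left_id 1 fps_scale.
Proof. by move=> a; apply: fpsP => n /=; rewrite mul1r. Qed.

Fact fps_scaleDr : right_distributive fps_scale +%R.
Proof. by move=> x a b; apply: fpsP => n /=; rewrite mulrDr. Qed.

Fact fps_scaleDl a : {morph fps_scale^~ a : x y / x + y}.
Proof. by move=> x y; apply: fpsP => n /=; rewrite mulrDl. Qed.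

HB.instance Definition _ := GRing.Zmodule_isLmodule.Build R (fps R)
  fps_scaleA fps_scale1 fps_scaleDr fps_scaleDl.

Fact fps_scaleAl x a b : x *: (a * b) = x *: a * b.
Proof.
apply: fpsP => n /=; rewrite mulr_sumr.
by apply: eq_bigr => i _; rewrite mulrA.
Qed.

HB.instance Definition _ := GRing.Lmodule_isLalgebra.Build R (fps R) fps_scaleAl.

Lemma fps_coefB a b n : fps_coef (a - b) n = fps_coef a n - fps_coef b n.
Proof. by []. Qed.

Lemma fps_coefM a b n :
  fps_coef (a * b) n = \sum_(i < n.+1) fps_coef a i * fps_coef b (n - i).
Proof. by []. Qed.

Lemma fps_coefZ x a n : fps_coef (x *: a) n = x * fps_coef a n.
Proof. by []. Qed.

Lemma fps_coef1 n : fps_coef (1 : fps R) n = (n == 0)%:R.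
Proof. by []. Qed.

End FpsRing.

Section DegenerateStirling.
Variable R : realType.
Implicit Types (lambda y : R) (s : nat -> R).

(* \sum_n s_n t^n / n! *)
Definition egf s : fps R := FPS (fun n => s n / n`!%:R).

(* egf_coef A n is the number s_n in A = \sum_n s_n t^n / n! *)
Definition egf_coef (A : fps R) (n : nat) : R := n`!%:R * fps_coef A n.

Lemma egf_coefK A : egf (egf_coef A) = A.
Proof.
apply: fpsP => n; rewrite /= /egf_coef mulrAC divff ?mul1r //.
by rewrite pnatr_eq0 -lt0n fact_gt0.
Qed.

(* (y | lambda)_n *)
Definition degenerate_ffact lambda y n : R :=
  \prod_(i < n) (y - i%:R * lambda).

(* (1 + lambda t)^(y / lambda), which is e^(y t) for lambda = 0 *)
Definition degenerate_exp lambda y : fps R := egf (degenerate_ffact lambda y).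

Definition stirling2_series lambda k : fps R :=
  k`!%:R^-1 *: (degenerate_exp lambda 1 - 1) ^+ k.

(* S_{2,lambda}(n, k) *)
Definition stirling2 lambda n k : R := egf_coef (stirling2_series lambda k) n.

Definition ext_stirling2_series lambda r k : fps R :=
  k`!%:R^-1 *: (degenerate_exp lambda r%:R * (degenerate_exp lambda 1 - 1) ^+ k).

(* S_{2,r}(N, K | lambda). Both arguments are shifted by r, that is N = n + r
   and K = k + r; the truncated subtractions give irrelevant values when
   N < r or K < r. *)
Definition ext_stirling2 lambda r N K : R :=
  egf_coef (ext_stirling2_series lambda r (K - r)) (N - r).

Lemma fps_coef_exp_lt (A : fps R) k n :
  fps_coef A 0 = 0 -> (n < k)%N -> fps_coef (A ^+ k) n = 0.
Proof.
move=> A0; elim: k n => // k IHk n nk.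
rewrite exprS fps_coefM big1 // => -[[|i] ? _] /=; first by rewrite A0 mul0r.
by rewrite IHk ?mulr0 //; lia.
Qed.

Lemma degenerate_expB1_coef0 lambda :
  fps_coef (degenerate_exp lambda 1 - 1) 0 = 0.
Proof.
by rewrite fps_coefB fps_coef1 /= /degenerate_ffact big_ord0 divr1 subrr.
Qed.

(* With the _small lemmas, these _egf lemmas are the defining equations
   "series = \sum_(n >= k) s_n t^n / n!". *)
Lemma stirling2_egf lambda k :
  stirling2_series lambda k = egf (stirling2 lambda ^~ k).
Proof. by rewrite egf_coefK. Qed.

Lemma stirling2_small lambda n k : (n < k)%N -> stirling2 lambda n k = 0.
Proof.
move=> nk; rewrite /stirling2 /egf_coef fps_coefZ.
by rewrite fps_coef_exp_lt ?mulr0 // degenerate_expB1_coef0.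
Qed.

Lemma ext_stirling2_egf lambda r k :
  ext_stirling2_series lambda r k =
  egf (fun n => ext_stirling2 lambda r (n + r) (k + r)).
Proof.
rewrite -[LHS]egf_coefK; congr egf; apply/funext => n.
by rewrite /ext_stirling2 !addnK.
Qed.

Lemma ext_stirling2_small lambda r n k :
  (n < k)%N -> ext_stirling2 lambda r (n + r) (k + r) = 0.
Proof.
move=> nk; rewrite /ext_stirling2 !addnK /egf_coef fps_coefZ fps_coefM.
rewrite big1 ?mulr0 // => i _; rewrite fps_coef_exp_lt ?mulr0 //.
  exact: degenerate_expB1_coef0.
exact: leq_ltn_trans (leq_subr _ _) nk.
Qed.

End DegenerateStirling.

(* Main.v *)
Require Import Defs.
From mathcomp Require Import all_boot all_order all_algebra.
From mathcomp Require Import reals.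

Import GRing.Theory Num.Theory.

Local Open Scope ring_scope.

(** Multiplying the generating function of [S_{2,r}(. + r, m + r | lambda)] by
    that of [S_{2,lambda}(., k)] merges the powers of [(1 + lambda t)^(1 / lambda) - 1],
    and [1 / (m! k!) = 'C(m + k, m) / (m + k)!]. Compare the coefficients of [t^n / n!]:
    the terms of the binomial convolution outside [m <= l <= n - k] vanish. *)

Lemma fact_natr_neq0 (R : numDomainType) n : n`!%:R != 0 :> R.
Proof. by rewrite pnatr_eq0 -lt0n fact_gt0. Qed.

Lemma bin_natr_fact (R : numFieldType) m n : (m <= n)%N ->
  'C(n, m)%:R = n`!%:R / (m`!%:R * (n - m)`!%:R) :> R.
Proof.
move=> mn; rewrite -(bin_fact mn) !natrM mulfK //.
by rewrite mulf_neq0 ?fact_natr_neq0.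
Qed.

(** Inside the Cauchy product, [n!] splits as ['C(n, l) * l! * (n - l)!], one factorial for each
    coefficient. *)
Lemma egf_coefM (R : realType) (A B : fps R) n :
  egf_coef (A * B) n =
  \sum_(0 <= l < n.+1) 'C(n, l)%:R * egf_coef A l * egf_coef B (n - l).
Proof.
rewrite /egf_coef fps_coefM mulr_sumr big_mkord; apply: eq_bigr => l _.
rewrite -(bin_fact (leq_ord l)) !natrM.
by rewrite -!mulrA; do 2!congr (_ * _); rewrite mulrCA.
Qed.

Lemma ext_stirling2_seriesM (R : realType) (lambda : R) r m k :
  ext_stirling2_series lambda r m * stirling2_series lambda k =
  'C(m + k, m)%:R *: ext_stirling2_series lambda r (m + k).
Proof.
rewrite /ext_stirling2_series /stirling2_series.
(* [scalerAl] frees a scalar from the left factor only: the product is commuted to extract the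
   inverse of [k!], then commuted back so that [exprD] merges the powers. *)
rewrite -scalerAl [X in _ *: X]mulrC -scalerAl mulrC -mulrA -exprD !scalerA.
rewrite bin_natr_fact ?leq_addr // addKn invfM mulrAC divff ?mul1r //.
exact: fact_natr_neq0.
Qed.

Theorem theorem2p6 (R : realType) (lambda : R) (r n m k : nat)
    (hnmk : (m + k <= n)%N) :
  'C(m + k, m)%:R * ext_stirling2 lambda r (n + r) (m + k + r) =
  \sum_(m <= l < (n - k).+1)
     'C(n, l)%:R * ext_stirling2 lambda r (l + r) (m + r) *
     stirling2 lambda (n - l) k.
Proof.
have kn : (k <= n)%N := leq_trans (leq_addl _ _) hnmk.
have mnk : (m <= n - k)%N by rewrite leq_subRL // addnC.
transitivity (egf_coef
    (ext_stirling2_series lambda r m * stirling2_series lambda k) n).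
  rewrite ext_stirling2_seriesM /ext_stirling2 !addnK /egf_coef fps_coefZ.
  by rewrite mulrCA.
(* Cut at [m]: below it the first Stirling factor vanishes. *)
rewrite egf_coefM (big_cat_nat (n := m)) //=; last first.
  by rewrite ltnW // ltnS (leq_trans mnk) ?leq_subr.
rewrite big_nat big1 ?add0r => [|l /andP[_ lm]]; last first.
  have /eqP := ext_stirling2_small lambda r lm.
  by rewrite /ext_stirling2 !addnK => /eqP->; rewrite mulr0 mul0r.
(* Cut after [n - k]: beyond it [n - l < k], so the second Stirling factor vanishes. *)
rewrite (big_cat_nat (n := (n - k).+1)) ?ltnS ?leq_subr ?(leqW mnk) //=.
rewrite [X in _ + X]big_nat [X in _ + X]big1 ?addr0 => [|l /andP[nkl ln]];
  last first.
  have nlk : (n - l < k)%N by rewrite ltn_subLR // addnC -ltn_subLR.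
  by rewrite -/(stirling2 _ _ _) stirling2_small ?mulr0.
by apply: eq_bigr => l _; rewrite /ext_stirling2 !addnK.
Qed.
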